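(* Let $\mathrm{T}\in\Lambda^3(\mathbb{R}^n)$ be a $3$-form. If there exists a non-zero spinor $\psi\in\Delta_n$ such that $\mathfrak{g}_{\mathrm{T}}^*\cdot\psi=0$, then $\mathrm{T}=0$.
   Context: $\mathbb{R}^n$ carries its standard inner product. $\mathrm{Cl}(\mathbb{R}^n)$ is the Clifford algebra with convention $X\cdot X=-\|X\|^2$; as a vector space it is identified with $\Lambda^*(\mathbb{R}^n)$ (via $e_{i_1}\wedge\dots\wedge e_{i_k}\mapsto e_{i_1}\cdots e_{i_k}$ for an orthonormal basis), and $\mathfrak{cl}(\mathbb{R}^n)$ is the Lie algebra with bracket $[\alpha,\beta]=\alpha\cdot\beta-\beta\cdot\alpha$. $\Delta_n$ is the complex vector space of $n$-dimensional spinors, on which $\mathrm{Cl}(\mathbb{R}^n)$, and hence exterior forms, act (Clifford multiplication). $X\lrcorner\,\mathrm{T}$ denotes the interior product. $\mathfrak{g}_{\mathrm{T}}^*$ is the Lie subalgebra of $\mathfrak{cl}(\mathbb{R}^n)$ generated by all $X\lrcorner\,\mathrm{T}$, $X\in\mathbb{R}^n$. The condition $\mathfrak{g}_{\mathrm{T}}^*\cdot\psi=0$ means that every element of $\mathfrak{g}_{\mathrm{T}}^*$ annihilates $\psi$. *)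

(* Defs.v *)
From HB Require Import structures.
From mathcomp Require Import all_boot all_order all_algebra.
From mathcomp Require Import classical_sets reals complex mxtens.
From mathcomp Require Import ring.

Set Implicit Arguments.
Unset Strict Implicit.
Unset Printing Implicit Defensive.

Import Order.TTheory GRing.Theory Num.Theory.

Local Open Scope ring_scope.
Local Open Scope complex_scope.

(* An element of Lambda^*(R^n) is the family of its coefficients in the basis
   e_A = e_{i_1} /\ ... /\ e_{i_k}, A = {i_1 < ... < i_k}, for the standard
   orthonormal basis (e_i) of R^n = 'rV[R]_n. *)
Definition exterior (R : realType) (n : nat) := {ffun {set 'I_n} -> R}.

HB.instance Definition _ (R : realType) (n : nat) :=
  GRing.Lmodule.copy (exterior R n) {ffun {set 'I_n} -> R^o}.

Definition is_form (R : realType) (n k : nat) (w : exterior R n) : Prop :=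
  forall A : {set 'I_n}, #|A| != k -> w A = 0.

(* (X _| w)(Y_1, ..., Y_k) = w(X, Y_1, ..., Y_k); moving e_i past the smaller
   elements of A gives the sign. *)
Definition contract (R : realType) (n : nat) (X : 'rV[R]_n) (w : exterior R n)
    : exterior R n :=
  [ffun A : {set 'I_n} => \sum_(i < n | i \notin A)
     X 0 i * (-1) ^+ #|[set j : 'I_n in A | (j < i)%N]| * w (i |: A)].

(* Cl(R^n) has the same underlying space, e_A being read as the Clifford product
   e_{i_1} ... e_{i_k}. *)
Definition Cl (R : realType) (n : nat) := exterior R n.

HB.instance Definition _ (R : realType) (n : nat) :=
  GRing.Lmodule.copy (Cl R n) (exterior R n).

Definition symdiff (T : finType) (A B : {set T}) : {set T} :=
  (A :\: B) :|: (B :\: A).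

(* e_A e_B = (-1)^s e_{symdiff A B}, where s counts the pairs (a, b) in A x B
   with b < a (transpositions needed to sort) or b = a (e_a e_a = -1). *)
Definition cl_sign (n : nat) (A B : {set 'I_n}) : bool :=
  odd #|[set p : 'I_n * 'I_n | [&& p.1 \in A, p.2 \in B & (p.2 <= p.1)%N]]|.

Definition cl_one (R : realType) (n : nat) : Cl R n :=
  [ffun A : {set 'I_n} => (A == finset.set0)%:R].

Definition cl_mul (R : realType) (n : nat) (a b : Cl R n) : Cl R n :=
  [ffun C : {set 'I_n} => \sum_(A : {set 'I_n}) \sum_(B : {set 'I_n} | symdiff A B == C)
     (-1) ^+ cl_sign A B * a A * b B].

Section SymdiffTheory.
Variable T : finType.
Implicit Types A B C : {set T}.

Lemma in_symdiff A B x : (x \in symdiff A B) = (x \in A) (+) (x \in B).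
Proof. by rewrite !inE; case: (x \in A); case: (x \in B). Qed.

Lemma symdiffC A B : symdiff A B = symdiff B A.
Proof. by apply/setP=> x; rewrite !in_symdiff addbC. Qed.

Lemma symdiffA A B C : symdiff A (symdiff B C) = symdiff (symdiff A B) C.
Proof. by apply/setP=> x; rewrite !in_symdiff addbA. Qed.

Lemma symdiffK A B : symdiff A (symdiff A B) = B.
Proof. by apply/setP=> x; rewrite !in_symdiff addKb. Qed.

Lemma symdiff0s B : symdiff finset.set0 B = B.
Proof. by apply/setP=> x; rewrite in_symdiff inE. Qed.

Lemma symdiffs0 B : symdiff B finset.set0 = B.
Proof. by rewrite symdiffC symdiff0s. Qed.

Lemma symdiff_eq A B C : (symdiff A B == C) = (B == symdiff A C).
Proof. by apply/eqP/eqP=> [<-|->]; rewrite symdiffK. Qed.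

Lemma symdiffs_eq0 A C : (symdiff A C == finset.set0) = (A == C).
Proof. by rewrite symdiff_eq symdiffs0 eq_sym. Qed.

Lemma symdiff_inj A : injective (symdiff A).
Proof. by move=> B C /(congr1 (symdiff A)); rewrite !symdiffK. Qed.

End SymdiffTheory.

Section SignTheory.
Variable n : nat.
Implicit Types A B C : {set 'I_n}.

Lemma cl_signE A B :
  cl_sign A B = \big[addb/false]_a \big[addb/false]_b
     [&& a \in A, b \in B & (b <= a)%N].
Proof.
rewrite /cl_sign -sum1_card (big_morph odd oddD (erefl : odd 0 = false)).
rewrite pair_big big_mkcond /=; apply: eq_bigr => p _.
by rewrite !inE andbA; case: ifP.
Qed.

Lemma cl_signDl A B C : cl_sign (symdiff A B) C = cl_sign A C (+) cl_sign B C.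
Proof.
rewrite !cl_signE -big_split; apply: eq_bigr => a _.
rewrite -big_split; apply: eq_bigr => b _.
by rewrite in_symdiff; case: (a \in A); case: (a \in B); case: (b \in C); case: leq.
Qed.

Lemma cl_signDr A B C : cl_sign A (symdiff B C) = cl_sign A B (+) cl_sign A C.
Proof.
rewrite !cl_signE -big_split; apply: eq_bigr => a _.
rewrite -big_split; apply: eq_bigr => b _.
by rewrite in_symdiff; case: (a \in A); case: (b \in B); case: (b \in C); case: leq.
Qed.

Lemma cl_sign0s B : cl_sign finset.set0 B = false.
Proof. by rewrite cl_signE !big1 // => a _; rewrite big1 // => b _; rewrite inE. Qed.

Lemma cl_signs0 A : cl_sign A finset.set0 = false.
Proof.
by rewrite cl_signE !big1 // => a _; rewrite big1 // => b _; rewrite inE andbF.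
Qed.

End SignTheory.

Section ClTheory.
Variables (R : realType) (n : nat).
Implicit Types a b c : Cl R n.

Lemma cl_mulE a b C :
  cl_mul a b C =
  \sum_A (-1) ^+ cl_sign A (symdiff A C) * a A * b (symdiff A C).
Proof.
rewrite ffunE; apply: eq_bigr => A _.
rewrite (eq_bigl (pred1 (symdiff A C))); last by move=> B; rewrite symdiff_eq.
by rewrite big_pred1_eq.
Qed.

Lemma cl_mulA : associative (@cl_mul R n).
Proof.
move=> a b c; apply/ffunP=> D; rewrite !cl_mulE.
under eq_bigr => A _ do rewrite cl_mulE mulr_sumr.
under [RHS]eq_bigr => E _ do rewrite cl_mulE mulr_sumr mulr_suml.
rewrite [RHS]exchange_big /=; apply: eq_bigr => A _.
rewrite [RHS](reindex_inj (@symdiff_inj _ A)) /=; apply: eq_bigr => B _.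
rewrite symdiffK -symdiffA.
have -> : symdiff A (symdiff B D) = symdiff B (symdiff A D).
  by rewrite !symdiffA (symdiffC A).
set F := symdiff B (symdiff A D).
have -> : symdiff A D = symdiff B F by rewrite /F symdiffK.
rewrite cl_signDr cl_signDl !signr_addb.
by ring.
Qed.

Lemma cl_mul1l : left_id (cl_one R n) (@cl_mul R n).
Proof.
move=> a; apply/ffunP=> C; rewrite cl_mulE (bigD1 finset.set0) //= big1.
  by rewrite ffunE eqxx symdiff0s cl_sign0s expr0 mul1r mul1r addr0.
by move=> A /negPf A0; rewrite ffunE A0 mulr0 mul0r.
Qed.

Lemma cl_mul1r : right_id (cl_one R n) (@cl_mul R n).
Proof.
move=> a; apply/ffunP=> C; rewrite cl_mulE (bigD1 C) //= big1.
  have -> : symdiff C C = finset.set0 by apply/eqP; rewrite symdiffs_eq0.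
  by rewrite ffunE eqxx cl_signs0 expr0 mul1r mulr1 addr0.
by move=> A /negPf A0; rewrite ffunE symdiffs_eq0 A0 mulr0.
Qed.

Lemma cl_mulDl : left_distributive (@cl_mul R n) +%R.
Proof.
move=> a b c; apply/ffunP=> C; rewrite [RHS]ffunE !cl_mulE -big_split.
by apply: eq_bigr => A _; rewrite ffunE mulrDr mulrDl.
Qed.

Lemma cl_mulDr : right_distributive (@cl_mul R n) +%R.
Proof.
move=> a b c; apply/ffunP=> C; rewrite [RHS]ffunE !cl_mulE -big_split.
by apply: eq_bigr => A _; rewrite ffunE mulrDr.
Qed.

Lemma cl_one_neq0 : cl_one R n != 0.
Proof.
apply/eqP=> /ffunP/(_ finset.set0); rewrite !ffunE eqxx => /eqP.
by rewrite oner_eq0.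
Qed.

Lemma cl_scaleAl (k : R) a b : k *: (cl_mul a b) = cl_mul (k *: a) b.
Proof.
apply/ffunP=> C; rewrite ffunE !cl_mulE scaler_sumr.
by apply: eq_bigr => A _; rewrite ffunE /GRing.scale /= !mulrA [k * _]mulrC.
Qed.

Lemma cl_scaleAr (k : R) a b : k *: (cl_mul a b) = cl_mul a (k *: b).
Proof.
apply/ffunP=> C; rewrite ffunE !cl_mulE scaler_sumr.
by apply: eq_bigr => A _; rewrite ffunE /GRing.scale /= mulrCA.
Qed.

End ClTheory.

HB.instance Definition _ (R : realType) (n : nat) :=
  GRing.Zmodule_isNzRing.Build (Cl R n) (@cl_mulA R n) (@cl_mul1l R n)
    (@cl_mul1r R n) (@cl_mulDl R n) (@cl_mulDr R n) (@cl_one_neq0 R n).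

HB.instance Definition _ (R : realType) (n : nat) :=
  GRing.Lmodule_isLalgebra.Build R (Cl R n) (@cl_scaleAl R n).

HB.instance Definition _ (R : realType) (n : nat) :=
  GRing.Lalgebra_isAlgebra.Build R (Cl R n) (@cl_scaleAr R n).

Definition cl_vec (R : realType) (n : nat) (X : 'rV[R]_n) : Cl R n :=
  [ffun A : {set 'I_n} => \sum_(i < n | A == [set i]) X 0 i].

Definition cl_bracket (R : realType) (n : nat) (a b : Cl R n) : Cl R n :=
  a * b - b * a.

Definition lie_subalgebra (R : realType) (n : nat) (S : set (Cl R n)) : Prop :=
  [/\ S 0,
      forall a b, S a -> S b -> S (a + b),
      forall (k : R) a, S a -> S (k *: a) &
      forall a b, S a -> S b -> S (cl_bracket a b)].

Definition g_star (R : realType) (n : nat) (T : exterior R n) : set (Cl R n) :=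
  smallest (@lie_subalgebra R n) (range (fun X => contract X T : Cl R n)).

(* Delta_n = C^2 (x) ... (x) C^2, k factors, k = n / 2 rounded down. *)
Fixpoint spin_dim (k : nat) : nat :=
  if k is k'.+1 then (spin_dim k' * 2)%N else 1%N.

Definition spinor (R : realType) (n : nat) := 'cV[R[i]]_(spin_dim n./2).

Definition mx22 (K : nzRingType) (a b c d : K) : 'M[K]_2 :=
  \matrix_(i < 2, j < 2)
    if i == 0 then (if j == 0 then a else b) else (if j == 0 then c else d).

Definition spin_g1 (R : realType) : 'M[R[i]]_2 := mx22 'i 0 0 (- 'i).
Definition spin_g2 (R : realType) : 'M[R[i]]_2 := mx22 0 'i 'i 0.
Definition spin_t (R : realType) : 'M[R[i]]_2 := mx22 0 (- 'i) 'i 0.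

(* The recursion unfolds to the usual formulas, written here with indices
   starting from 0 and g_1, g_2, t for the three matrices above:
     e_{2l}   |-> 1 (x) ... (x) 1 (x) g_1 (x) t (x) ... (x) t   (l factors t)
     e_{2l+1} |-> 1 (x) ... (x) 1 (x) g_2 (x) t (x) ... (x) t   (l factors t)
   for l < k and, when n = 2k+1, e_{2k} |-> i t (x) ... (x) t, which fixes
   one of the two irreducible complex modules of Cl(R^n) for n odd. *)
Fixpoint gamma (R : realType) (k j : nat) {struct k} : 'M[R[i]]_(spin_dim k) :=
  if k is k'.+1 return 'M[R[i]]_(spin_dim k) then
    match j with
    | 0 => (1%:M : 'M_(spin_dim k')) *t spin_g1 R
    | 1 => (1%:M : 'M_(spin_dim k')) *t spin_g2 R
    | j'.+2 => gamma R k' j' *t spin_t R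
    end
  else ('i)%:M.

(* Clifford multiplication by e_A = e_{i_1} ... e_{i_k}; the product is taken in
   increasing order of the indices. *)
Definition blade (R : realType) (n : nat) (A : {set 'I_n})
    : 'M[R[i]]_(spin_dim n./2) :=
  \prod_(i < n | i \in A) gamma R n./2 i.

Definition spin_rep (R : realType) (n : nat) (a : Cl R n)
    : 'M[R[i]]_(spin_dim n./2) :=
  \sum_(A : {set 'I_n}) (a A)%:C *: blade R A.

Definition clifford_act (R : realType) (n : nat) (a : Cl R n) (psi : spinor R n)
    : spinor R n := spin_rep a *m psi.

Lemma cl_coefM (R : realType) (n : nat) (a b : Cl R n) C :
  (a * b) C =
  \sum_A (-1) ^+ cl_sign A (symdiff A C) * a A * b (symdiff A C).
Proof. exact: cl_mulE. Qed.

Section VectorTheory.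
Variables (R : realType) (n : nat).
Implicit Types (X : 'rV[R]_n) (w : Cl R n) (A C : {set 'I_n}).

Lemma cl_vec1 X i : cl_vec X [set i]%SET = X 0 i.
Proof.
rewrite ffunE (eq_bigl (pred1 i)) ?big_pred1_eq // => j /=.
by rewrite eq_sym (inj_eq set1_inj).
Qed.

Lemma sum_cl_vec X (F : {set 'I_n} -> R) :
  \sum_A cl_vec X A * F A = \sum_i X 0 i * F [set i]%SET.
Proof.
under eq_bigr => A _ do rewrite ffunE mulr_suml big_mkcond /=.
rewrite exchange_big; apply: eq_bigr => i _.
rewrite (bigD1 [set i]%SET) //= eqxx big1 ?addr0 // => A /negPf ->.
by [].
Qed.

Lemma cl_vecMl X w C :
  (cl_vec X * w) C = \sum_i X 0 i *
    ((-1) ^+ cl_sign [set i]%SET (symdiff [set i]%SET C) * w (symdiff [set i]%SET C)).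
Proof.
rewrite cl_coefM -(sum_cl_vec X (fun A => (-1) ^+ cl_sign A (symdiff A C) * w (symdiff A C))).
by apply: eq_bigr => A _; ring.
Qed.

Lemma cl_vecMr X w C :
  (w * cl_vec X) C = \sum_i X 0 i *
    ((-1) ^+ cl_sign (symdiff [set i]%SET C) [set i]%SET * w (symdiff [set i]%SET C)).
Proof.
rewrite cl_coefM -(sum_cl_vec X (fun A => (-1) ^+ cl_sign (symdiff A C) A * w (symdiff A C))).
rewrite (reindex_inj (@symdiff_inj _ C)) /=; apply: eq_bigr => A _.
rewrite [symdiff (symdiff C A) C]symdiffC symdiffK [symdiff C A]symdiffC.
by ring.
Qed.

Lemma cl_sign1l (i : 'I_n) (B : {set 'I_n}) : cl_sign [set i]%SET B = odd #|[set j : 'I_n in B | (j <= i)%N]|.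
Proof.
rewrite cl_signE (bigD1 i) //= [X in _ (+) X]big1 ?addbF; last first.
  by move=> a /negPf ai; rewrite big1 // => b _; rewrite inE ai.
rewrite -sum1_card (big_morph odd oddD (erefl : odd 0 = false)) [RHS]big_mkcond /=.
by apply: eq_bigr => b _; rewrite !inE eqxx /=; case: ifP.
Qed.

Lemma cl_sign1r (i : 'I_n) (B : {set 'I_n}) : cl_sign B [set i]%SET = odd #|[set j : 'I_n in B | (i <= j)%N]|.
Proof.
rewrite cl_signE exchange_big (bigD1 i) //= [X in _ (+) X]big1 ?addbF; last first.
  by move=> a /negPf ai; rewrite big1 // => b _; rewrite inE ai andbF.
rewrite -sum1_card (big_morph odd oddD (erefl : odd 0 = false)) [RHS]big_mkcond /=.
by apply: eq_bigr => b _; rewrite !inE eqxx /=; case: ifP.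
Qed.

Lemma cl_sign1C (i : 'I_n) (B : {set 'I_n}) :
  cl_sign [set i]%SET B (+) cl_sign B [set i]%SET = odd #|B| (+) (i \in B).
Proof.
rewrite cl_sign1l cl_sign1r -!sum1_card !(big_morph odd oddD (erefl : odd 0 = false)).
rewrite ![\big[addb/_]_(_ in _) _]big_mkcond -big_split /=.
have -> : (i \in B) = \big[addb/false]_j ((j == i) && (i \in B)).
  by rewrite (bigD1 i) //= eqxx big1 ?addbF // => j /negPf ->.
rewrite -big_split; apply: eq_bigr => j _ /=.
rewrite !inE -val_eqE /=.
case: ltngtP => [lt|lt|/val_inj ->]; case: (_ \in B) => //.
Qed.

Definition cl_basis A : Cl R n := [ffun B => (B == A)%:R].

Lemma cl_basis0 : cl_basis finset.set0 = 1.
Proof. by []. Qed.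

Lemma cl_basisM A B :
  cl_basis A * cl_basis B = (-1) ^+ cl_sign A B *: cl_basis (symdiff A B).
Proof.
have bE D E : cl_basis D E = (E == D)%:R by rewrite ffunE.
apply/ffunP=> C; rewrite cl_coefM (bigD1 A) //= big1 ?addr0; last first.
  by move=> A' /negPf AA; rewrite bE AA mulr0 mul0r.
rewrite [RHS]ffunE !bE eqxx mulr1 symdiff_eq /GRing.scale /=.
by case: eqP => [->|_]; rewrite ?symdiffK // !mulr0.
Qed.

Lemma cl_vecE X : cl_vec X = \sum_i X 0 i *: cl_basis [set i]%SET.
Proof.
apply/ffunP=> A; rewrite sum_ffunE ffunE big_mkcond; apply: eq_bigr => i _.
by rewrite !ffunE /GRing.scale /=; case: eqP; rewrite ?mulr1 ?mulr0.
Qed.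

(* The defining relation X . X = - |X|^2. *)
Lemma cl_vec_sqr X : cl_vec X * cl_vec X = - (\sum_i X 0 i ^+ 2) *: 1.
Proof.
have anti (i j : 'I_n) : cl_basis [set i]%SET * cl_basis [set j]%SET +
    cl_basis [set j]%SET * cl_basis [set i]%SET = - ((i == j)%:R *+ 2) *: 1.
  rewrite !cl_basisM [symdiff [set j]%SET _]symdiffC -scalerDl.
  have := cl_sign1C i [set j]%SET; rewrite cards1 inE.
  have [<-|ij] := eqVneq i j.
    have -> : symdiff [set i]%SET [set i]%SET = finset.set0.
      by apply/eqP; rewrite symdiffs_eq0.
    rewrite cl_sign1l => _.
    have -> : [set j : 'I_n in [set i]%SET | (j <= i)%N]%SET = [set i]%SET.
      by apply/setP=> k; rewrite !inE; case: eqP => // ->; rewrite leqnn.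
    by rewrite cards1 /= cl_basis0 expr1 -mulr2n mulNrn.
  move=> /= E; have -> : cl_sign [set j]%SET [set i]%SET =
     ~~ cl_sign [set i]%SET [set j]%SET by move: E; do 2 case: cl_sign.
  by rewrite signrN subrr mul0rn oppr0 !scale0r.
have two0 : (2%:R : R) != 0 by rewrite pnatr_eq0.
apply: (scalerI two0); rewrite !scaler_nat mulr2n.
have VV : cl_vec X * cl_vec X = \sum_i \sum_j (X 0 i * X 0 j) *:
    (cl_basis [set i]%SET * cl_basis [set j]%SET).
  rewrite cl_vecE mulr_suml; apply: eq_bigr => i _.
  rewrite mulr_sumr; apply: eq_bigr => j _.
  by rewrite -scalerAl -scalerAr scalerA.
rewrite VV [X in X + _]exchange_big -big_split /=.
rewrite -sumrN scaler_suml -sumrMnl; apply: eq_bigr => i _.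
rewrite -big_split /= (bigD1 i) //= big1 ?addr0; last first.
  move=> j /negPf ji; rewrite [X 0 j * _]mulrC -scalerDr anti ji.
  by rewrite mul0rn oppr0 scale0r scaler0.
rewrite -scalerDr anti eqxx scalerA -[RHS]scaler_nat scalerA; congr (_ *: _) => /=; ring.
Qed.

(* Interior and Clifford products: X . w - (-1)^k w . X = - 2 X _| w
   for w in Lambda^k(R^n). *)
Lemma contractE k X w : is_form k w ->
  cl_vec X * w - (-1) ^+ k *: (w * cl_vec X) = - 2 *: (contract X w : Cl R n).
Proof.
move=> wk; apply/ffunP=> C; rewrite [LHS]ffunE [X in _ + X]ffunE [X in - X]ffunE.
rewrite cl_vecMl cl_vecMr scaler_sumr -sumrB [RHS]ffunE ffunE scaler_sumr.
rewrite [RHS]big_mkcond /=; apply: eq_bigr => i _.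
set A := symdiff _ C.
have [Ak|/wk wA] := eqVneq #|A| k; last first.
  case: ifP => [iC|_]; last by rewrite wA /GRing.scale /= !mulr0 subrr.
  have <- : A = i |: C.
    by apply/setP=> j; rewrite in_symdiff !inE; case: eqP => // ->; rewrite (negPf iC).
  by rewrite wA /GRing.scale /= !mulr0 subrr.
have := cl_sign1C i A; rewrite Ak.
have -> : (i \in A) = (i \notin C) by rewrite in_symdiff inE eqxx.
rewrite /GRing.scale /= -(signr_odd _ k).
case: (boolP (i \in C)) => iC /= E.
  have -> : cl_sign A [set i]%SET = odd k (+) cl_sign [set i]%SET A.
    by move: E; do 2 case: cl_sign; case: (odd k).
  rewrite signr_addb; case: (odd k); rewrite ?expr0 ?expr1; ring.
have -> : cl_sign A [set i]%SET = ~~ (odd k (+) cl_sign [set i]%SET A).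
  by move: E; do 2 case: cl_sign; case: (odd k).
have AE : A = i |: C.
  by apply/setP=> j; rewrite in_symdiff !inE; case: eqP => // ->; rewrite (negPf iC).
rewrite -AE cl_sign1l.
have -> : #|[set j : 'I_n in A | (j <= i)%N]| = #|[set j : 'I_n in C | (j < i)%N]|.+1.
  rewrite (cardsD1 i) AE !inE eqxx leqnn /=; congr (_.+1).
  apply: eq_card => j; rewrite !inE -val_eqE /=; case: ltngtP => //=.
  by rewrite andbF.
rewrite -(signr_odd _ #|[set j : 'I_n in C | (j < i)%N]|) /=.
by case: odd; case: (odd k); rewrite /= ?expr0 ?expr1; ring.
Qed.
End VectorTheory.

Section GammaTheory.
Variable R : realType.
Local Notation C := R[i].

Lemma tensmxNl m n p q (A : 'M[C]_(m, n)) (B : 'M[C]_(p, q)) :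
  (- A) *t B = - (A *t B).
Proof. by apply/matrixP=> i j; rewrite !mxE mulNr. Qed.

Lemma tensmxNr m n p q (A : 'M[C]_(m, n)) (B : 'M[C]_(p, q)) :
  A *t (- B) = - (A *t B).
Proof. by apply/matrixP=> i j; rewrite !mxE mulrN. Qed.

Lemma tensmx1 m n : (1%:M : 'M[C]_m) *t (1%:M : 'M_n) = 1%:M.
Proof.
apply/matrixP=> i j; case: (mxtens_indexP i) => i0 i1.
case: (mxtens_indexP j) => j0 j1; rewrite tensmxE !mxE -natrM mulnb.
by rewrite (inj_eq (can_inj (@mxtens_indexK _ _))) xpair_eqE.
Qed.

Lemma mx22M (a b c d a' b' c' d' : C) :
  mx22 a b c d *m mx22 a' b' c' d' =
  mx22 (a * a' + b * c') (a * b' + b * d') (c * a' + d * c') (c * b' + d * d').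
Proof.
by apply/matrixP=> [] [[|[|//]] ?] [[|[|//]] ?];
   rewrite !mxE !big_ord_recl big_ord0 !mxE /= addr0.
Qed.

Lemma mx22N (a b c d : C) : - mx22 a b c d = mx22 (- a) (- b) (- c) (- d).
Proof. by apply/matrixP=> i j; rewrite !mxE; do 2 case: (_ == 0). Qed.

Lemma mx22_1 : 1%:M = mx22 1 0 0 1 :> 'M[C]_2.
Proof.
by apply/matrixP=> [] [[|[|//]] ?] [[|[|//]] ?]; rewrite !mxE.
Qed.

Let ii : 'i * 'i = -1 :> C.
Proof. by rewrite -expr2 sqr_i. Qed.

Let simp := (mulr0, mul0r, addr0, add0r, mulrN, mulNr, ii, @opprK C, @oppr0 C).

Lemma spin_g1_sqr : spin_g1 R *m spin_g1 R = - 1%:M.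
Proof. by rewrite mx22M mx22_1 mx22N !simp. Qed.

Lemma spin_g2_sqr : spin_g2 R *m spin_g2 R = - 1%:M.
Proof. by rewrite mx22M mx22_1 mx22N !simp. Qed.

Lemma spin_t_sqr : spin_t R *m spin_t R = 1%:M.
Proof. by rewrite mx22M mx22_1 !simp. Qed.

Lemma spin_g12 : spin_g1 R *m spin_g2 R = - (spin_g2 R *m spin_g1 R).
Proof. by rewrite !mx22M mx22N !simp. Qed.

Lemma spin_g1t : spin_g1 R *m spin_t R = - (spin_t R *m spin_g1 R).
Proof. by rewrite !mx22M mx22N !simp. Qed.

Lemma spin_g2t : spin_g2 R *m spin_t R = - (spin_t R *m spin_g2 R).
Proof. by rewrite !mx22M mx22N !simp. Qed.

Lemma gamma_sqr k j : gamma R k j *m gamma R k j = - 1%:M.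
Proof.
elim: k j => [|k IHk] [|[|j]] /=.
1-3: by rewrite -scalar_mxM ii raddfN.
- by rewrite tensmx_mul mul1mx spin_g1_sqr tensmxNr tensmx1.
- by rewrite tensmx_mul mul1mx spin_g2_sqr tensmxNr tensmx1.
- by rewrite tensmx_mul IHk spin_t_sqr tensmxNl tensmx1.
Qed.

Lemma gamma_anti k i j : (i < j <= k.*2)%N ->
  gamma R k i *m gamma R k j = - (gamma R k j *m gamma R k i).
Proof.
elim: k i j => [|k IHk] i j; first by rewrite double0 leqn0 => /andP[ij /eqP j0]; rewrite j0 in ij.
case: i j => [|[|i]] [|[|j]] //=. all: rewrite !tensmx_mul ?mul1mx ?mulmx1.
- by rewrite spin_g12 tensmxNr.
- by rewrite spin_g1t tensmxNr.
- by rewrite spin_g2t tensmxNr.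
- by move=> /IHk ->; rewrite tensmxNl.
Qed.

End GammaTheory.

Section BladeTheory.
Variables (M : pzRingType) (n : nat) (g : 'I_n -> M).
Hypothesis g_sqr : forall i, g i * g i = -1.
Hypothesis g_anti : forall i j, i != j -> g i * g j = - (g j * g i).

Lemma mul_gen_seq i (A : {set 'I_n}) (s : seq 'I_n) :
    sorted (fun j k : 'I_n => (j < k)%N) s -> i \in s ->
  g i * \prod_(j <- s | j \in A) g j =
  (-1) ^+ count (fun j : 'I_n => (j \in A) && (j <= i)%N) s *
    \prod_(j <- s | j \in symdiff [set i]%SET A) g j.
Proof.
elim: s => // j s IHs /= s_sorted.
have /allP js : all (fun k : 'I_n => (j < k)%N) s.
  by apply: order_path_min s_sorted => x y z; apply: ltn_trans.
rewrite inE !big_cons in_symdiff inE; have [ij _|ij /= i_s] := eqVneq i j.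
  rewrite -ij leqnn andbT /=.
  have -> : count (fun j : 'I_n => (j \in A) && (j <= i)%N) s = 0%N.
    apply/eqP; rewrite -leqn0 leqNgt -has_count; apply/hasPn=> k /js.
    by rewrite -ij ltnNge => /negPf ->; rewrite andbF.
  have E : \prod_(j <- s | j \in symdiff [set i]%SET A) g j =
           \prod_(j <- s | j \in A) g j.
    rewrite big_seq_cond [RHS]big_seq_cond; apply: eq_bigl => k.
    have [/js|//] := boolP (k \in s).
    rewrite -ij in_symdiff inE => ik; suff /negPf -> : k != i by [].
    by rewrite -val_eqE /= gtn_eqF.
  by rewrite E; case: (i \in A); rewrite ?mul1r // mulrA g_sqr.
have {}IHs := IHs (path_sorted s_sorted) i_s.
have ji := js _ i_s; rewrite (ltnW ji) andbT.
case: (j \in A) => //=.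
by rewrite mulrA (g_anti ij) mulNr -mulrA IHs exprS mulN1r mulNr !mulrA commr_sign.
Qed.

Lemma mul_gen_blade i (A : {set 'I_n}) :
  g i * \prod_(j | j \in A) g j =
  (-1) ^+ cl_sign [set i]%SET A * \prod_(j | j \in symdiff [set i]%SET A) g j.
Proof.
have srt : sorted (fun j k : 'I_n => (j < k)%N) (index_enum 'I_n).
  have := iota_ltn_sorted 0 n.
  by rewrite -val_enum_ord sorted_map /index_enum -enumT.
rewrite (mul_gen_seq A srt (mem_index_enum i)) cl_sign1l -[in LHS]signr_odd; congr (_ ^+ nat_of_bool _ * _).
rewrite -sum1_card -sum1_count; congr odd; apply: eq_bigl => j; by rewrite !inE.
Qed.

Lemma mul_blade (A B : {set 'I_n}) :
  \prod_(j | j \in A) g j * \prod_(j | j \in B) g j =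
  (-1) ^+ cl_sign A B * \prod_(j | j \in symdiff A B) g j.
Proof.
have [m] := ubnP #|A|; elim: m A B => // m IHm A B Am.
have [->|/set0Pn[i iA]] := eqVneq A finset.set0.
  by rewrite cl_sign0s symdiff0s big_pred0 => [|j]; rewrite ?inE // mul1r.
have EA : A = symdiff [set i]%SET (A :\ i)%SET.
  by apply/setP=> j; rewrite in_symdiff !inE; case: eqP => // ->; rewrite iA.
have Bm : (#|A :\ i| < m)%N by move: Am; rewrite (cardsD1 i) iA.
move: (A :\ i)%SET EA Bm => A' EA Bm.
have E := mul_gen_blade i A'; rewrite -EA in E.
have -> : \prod_(j | j \in A) g j =
   (-1) ^+ cl_sign [set i]%SET A' * (g i * \prod_(j | j \in A') g j).
  by rewrite E mulrA -expr2 sqrr_sign mul1r.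
rewrite -!mulrA IHm // (mulrA (g i)) (commr_sign (g i)) -mulrA mul_gen_blade.
rewrite symdiffA -EA !mulrA -!signr_addb; congr (_ ^+ nat_of_bool _ * _).
by rewrite EA cl_signDl cl_signDr; do 3 case: cl_sign.
Qed.
End BladeTheory.

Section SpinRepTheory.
Variables (R : realType) (n : nat).

Lemma bladeM (A B : {set 'I_n}) :
  blade R A * blade R B = (-1) ^+ cl_sign A B * blade R (symdiff A B).
Proof.
apply: mul_blade => [i|i j]; first exact: gamma_sqr.
have le_k (k : 'I_n) : (k <= n./2.*2)%N.
  by rewrite -ltnS (leq_trans (ltn_ord k)) // -[X in (X <= _)%N]odd_double_half -add1n leq_add2r leq_b1.
rewrite -val_eqE /= neq_ltn => /orP[] ij.
  by apply: gamma_anti; rewrite ij le_k.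
by apply/esym/eqP; rewrite eqr_oppLR; apply/eqP/gamma_anti; rewrite ij le_k.
Qed.

Lemma spin_rep_vec (X : 'rV[R]_n) :
  spin_rep (cl_vec X) = \sum_i (X 0 i)%:C *: gamma R n./2 i.
Proof.
rewrite /spin_rep.
under eq_bigr => A _ do rewrite ffunE rmorph_sum scaler_suml big_mkcond /=.
rewrite exchange_big; apply: eq_bigr => i _.
rewrite (bigD1 [set i]%SET) //= eqxx big1 ?addr0 => [|A /negPf -> //].
by rewrite /blade (eq_bigl (pred1 i)) ?big_pred1_eq // => j; rewrite inE.
Qed.

Lemma spin_rep1 : spin_rep (1 : Cl R n) = 1.
Proof.
rewrite /spin_rep (bigD1 finset.set0) //= big1 ?addr0 => [|A /negPf A0].
  by rewrite ffunE eqxx scale1r /blade big_pred0 // => i; rewrite inE.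
by rewrite ffunE A0 scale0r.
Qed.

Lemma spin_repD (a b : Cl R n) : spin_rep (a + b) = spin_rep a + spin_rep b.
Proof.
rewrite -big_split; apply: eq_bigr => A _.
by rewrite ffunE rmorphD scalerDl.
Qed.

Lemma spin_repZ (k : R) (a : Cl R n) : spin_rep (k *: a) = k%:C *: spin_rep a.
Proof.
rewrite scaler_sumr; apply: eq_bigr => A _.
by rewrite ffunE rmorphM scalerA.
Qed.

Lemma spin_repM (a b : Cl R n) : spin_rep (a * b) = spin_rep a * spin_rep b.
Proof.
rewrite [RHS]mulr_suml.
under [RHS]eq_bigr => A _ do rewrite mulr_sumr.
under [LHS]eq_bigr => C _ do rewrite cl_coefM rmorph_sum scaler_suml.
rewrite exchange_big; apply: eq_bigr => A _ /=.
rewrite (reindex_inj (@symdiff_inj _ A)) /=; apply: eq_bigr => B _.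
rewrite symdiffK -[RHS]scalemxAl -[(_ *m _)]scalemxAr.
have -> : blade R A *m blade R B = (-1) ^+ cl_sign A B * blade R (symdiff A B).
  exact: bladeM.
have -> (b0 : bool) (N : 'M[R[i]]_(spin_dim n./2)) : (-1) ^+ b0 * N = ((-1) ^+ b0 : R[i]) *: N.
  by case: b0; rewrite ?expr0 ?expr1 ?mulN1r ?scaleN1r ?mul1r ?scale1r.
rewrite !rmorphM rmorph_sign /= !scalerA; congr (_ *: _); ring.
Qed.
End SpinRepTheory.

(* Main.v *)
Require Import Defs.
From mathcomp Require Import all_boot all_order all_algebra.
From mathcomp Require Import classical_sets reals complex.
From mathcomp Require Import ring zify.

Set Implicit Arguments.
Unset Strict Implicit.
Unset Printing Implicit Defensive.

Import Order.TTheory GRing.Theory Num.Theory.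

Local Open Scope ring_scope.

(** Write e_i for the standard basis vectors and w_i for the 2-form e_i _| T;
    each w_i lies in g_T^* and so kills psi.  Two identities in the Clifford algebra
    then finish the proof:
      sum_i e_i w_i = 3 T                         (sum_gen_contract)
      T^2 + sum_i w_i^2 = - 2 |T|^2               (sqr_form3D)
    where |T|^2 is the sum of the squares of the coefficients of T.  By the
    first T psi = 0, so the left-hand side of the second kills psi; thus
    |T|^2 psi = 0, and psi <> 0 forces |T|^2 = 0.

    Both identities come from - 2 w_i = e_i T + T e_i and from the operator
    w |-> sum_i e_i w e_i, which acts on Lambda^k by the scalar
    - (-1)^k (n - 2 k) (sum_gen_conj).  For the second identity one expands
    sum_i (e_i T + T e_i)^2, which yields
      4 sum_i w_i^2 = (n - 12) T^2 + sum_i e_i T^2 e_i.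
    The square of a 3-form has components in degrees 0 and 4 only
    (sqr_form3_eq0), on which the last sum acts by - n and - (n - 8).  So
    4 (T^2 + sum_i w_i^2) vanishes in degree 4 and is - 8 times the scalar part
    of T^2 in degree 0; that scalar part is |T|^2 (sqr_form3_0). *)

(** * Signs of products of basis blades *)

Section Signs.
Variable n : nat.
Implicit Types A B C : {set 'I_n}.

Lemma symdiffD1 i A : i \in A -> A = symdiff [set i]%SET (A :\ i)%SET.
Proof.
by move=> iA; apply/setP=> j; rewrite in_symdiff !inE; case: eqP => // ->; rewrite iA.
Qed.

Lemma card_symdiff A B :
  (#|symdiff A B| + (#|A :&: B|).*2 = #|A| + #|B|)%N.
Proof.
rewrite /symdiff cardsU.
have -> : ((A :\: B) :&: (B :\: A) = finset.set0)%SET.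
  by apply/setP=> x; rewrite !inE; case: (x \in A); case: (x \in B).
rewrite cards0 subn0 -(cardsID B A) -(cardsID A B) (finset.setIC B A); lia.
Qed.

(** Reversing e_A e_B: all #|A| * #|B| pairs are transposed, except that equal
    indices do not anticommute. *)
Lemma cl_signC A B :
  cl_sign A B (+) cl_sign B A = odd (#|A| * #|B|) (+) odd #|A :&: B|.
Proof.
have [m] := ubnP #|A|; elim: m A => // m IHm A Am.
have [->|/set0Pn[i iA]] := eqVneq A finset.set0.
  by rewrite cl_sign0s cl_signs0 finset.set0I cards0.
have Bm : (#|A :\ i| < m)%N by move: Am; rewrite (cardsD1 i) iA.
have E1 := IHm _ Bm; have E2 := cl_sign1C i B.
rewrite [in LHS](symdiffD1 iA) cl_signDl cl_signDr.
rewrite addbACA E1 E2 (cardsD1 i A) iA mulnDl mul1n oddD.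
rewrite (cardsD1 i (A :&: B)) inE iA /= oddD oddb.
have -> : ((A :\ i) :&: B = (A :&: B) :\ i)%SET.
  by apply/setP=> j; rewrite !inE andbA.
by case: (i \in B); do 3 case: odd.
Qed.

(** e_A^2 = (-1)^(k (k + 1) / 2) for #|A| = k: the sorting transpositions
    contribute k (k - 1) / 2 signs and the squares e_a e_a = -1 another k. *)
Lemma cl_signAA A : cl_sign A A = odd 'C(#|A|.+1, 2).
Proof.
have [m] := ubnP #|A|; elim: m A => // m IHm A Am.
have [->|/set0Pn[i iA]] := eqVneq A finset.set0.
  by rewrite cl_sign0s cards0.
have Bm : (#|A :\ i| < m)%N by move: Am; rewrite (cardsD1 i) iA.
have sii : cl_sign [set i]%SET [set i]%SET.
  rewrite cl_sign1l.
  have -> : [set j : 'I_n in [set i]%SET | (j <= i)%N]%SET = [set i]%SET.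
    by apply/setP=> k; rewrite !inE; case: eqP => // ->; rewrite leqnn.
  by rewrite cards1.
have := cl_sign1C i (A :\ i)%SET; rewrite !inE eqxx addbF /= => E.
rewrite [in LHS](symdiffD1 iA) cl_signDl !cl_signDr (IHm _ Bm) sii.
rewrite -addbA [X in true (+) X]addbA E [#|A|](cardsD1 i) iA add1n.
by rewrite [in RHS]binS bin1 oddD /=; do 2 case: odd.
Qed.

End Signs.

(** * Conjugation by the basis vectors *)

Section Algebra.
Variables (R : realType) (n : nat).
Implicit Types (w : Cl R n) (A C : {set 'I_n}) (i : 'I_n).

Local Notation e i := (cl_basis R [set i]%SET : Cl R n).

Lemma cl_coefD (a b : Cl R n) C : (a + b) C = a C + b C.
Proof. by rewrite ffunE. Qed.

Lemma cl_coefZ (k : R) (a : Cl R n) C : (k *: a) C = k * a C.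
Proof. by rewrite ffunE. Qed.

Lemma cl_coef1 C : (1 : Cl R n) C = (C == finset.set0)%:R.
Proof. by rewrite ffunE. Qed.

Lemma cl_vec_delta i : cl_vec (delta_mx 0 i) = e i.
Proof.
rewrite cl_vecE (bigD1 i) //= big1 => [|j /negPf ji]; last first.
  by rewrite mxE ji scale0r.
by rewrite mxE !eqxx scale1r addr0.
Qed.

Lemma gen_sqr i : e i * e i = -1.
Proof.
rewrite -cl_vec_delta cl_vec_sqr (bigD1 i) //= big1 => [|j /negPf ji].
  by rewrite mxE !eqxx expr1n addr0 scaleN1r.
by rewrite mxE ji expr0n.
Qed.

Lemma cl_basisMl A w C :
  (cl_basis R A * w) C = (-1) ^+ cl_sign A (symdiff A C) * w (symdiff A C).
Proof.
rewrite cl_coefM (bigD1 A) //= big1 ?addr0 => [|B /negPf BA].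
  by rewrite ffunE eqxx mulr1.
by rewrite ffunE BA mulr0 mul0r.
Qed.

Lemma cl_basisMr A w C :
  (w * cl_basis R A) C = (-1) ^+ cl_sign (symdiff A C) A * w (symdiff A C).
Proof.
have ACC : symdiff (symdiff A C) C = A.
  by rewrite [symdiff A C]symdiffC symdiffC symdiffK.
rewrite cl_coefM (bigD1 (symdiff A C)) //= ACC big1 ?addr0 => [|B BA].
  by rewrite ffunE eqxx mulr1.
rewrite ffunE; case: eqP => [BCA|]; last by rewrite mulr0.
by rewrite -BCA symdiffC [symdiff B C]symdiffC symdiffK eqxx in BA.
Qed.

Lemma gen_conj i w C :
  (e i * w * e i) C = (-1) ^+ (~~ (odd #|C| (+) (i \in C))) * w C.
Proof.
rewrite -mulrA cl_basisMl cl_basisMr symdiffK mulrA -signr_addb.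
rewrite cl_signDr -addbA cl_sign1C cl_signAA cards1.
by congr ((-1) ^+ nat_of_bool _ * _).
Qed.

(** e_i e_C e_i is e_C up to a sign that depends on whether i lies in C: the
    #|C| indices in C and the n - #|C| others contribute opposite signs. *)
Lemma sum_gen_conj w C :
  (\sum_i e i * w * e i) C = - (-1) ^+ #|C| * (n%:R - (#|C|).*2%:R) * w C.
Proof.
rewrite sum_ffunE (eq_bigr _ (fun i _ => gen_conj i w C)) -mulr_suml.
congr (_ * _).
under eq_bigr => i _ do rewrite signrN signr_addb signr_odd -mulNr.
rewrite -mulr_sumr; congr (_ * _).
rewrite (bigID (mem C)) /=.
rewrite (eq_bigr (fun=> -1)) => [|i ->]; last by rewrite expr1.
rewrite [X in _ + X](eq_bigr (fun=> 1)) => [|i /negPf ->]; last by rewrite expr0.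
rewrite !sumr_const mulNrn.
have /(congr1 (fun m => m%:R : R)) := cardC C; rewrite card_ord natrD => <-.
by rewrite -mul2n natrM; ring.
Qed.

(** * The square of a 3-form *)

Variables (T : Cl R n).
Hypothesis hT : is_form 3 T.

Local Notation omega i := (contract (delta_mx 0 i) T : Cl R n).

Lemma gen_anticomm i : e i * T + T * e i = - 2 *: omega i.
Proof.
have := contractE (delta_mx 0 i) hT; rewrite cl_vec_delta => <-.
by rewrite -signr_odd expr1 scaleN1r opprK.
Qed.

Lemma sum_gen_conj3 : \sum_i e i * T * e i = (n%:R - 6) *: T.
Proof.
apply/ffunP=> C; rewrite sum_gen_conj [RHS]ffunE.
have [->|/hT ->] := eqVneq #|C| 3%N; last by rewrite mulr0 scaler0.
by rewrite -signr_odd expr1 opprK mul1r.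
Qed.

Lemma sum_gen_contract : \sum_i e i * omega i = 3 *: T.
Proof.
have two0 : - 2 != 0 :> R by rewrite oppr_eq0 pnatr_eq0.
apply: (scalerI two0); rewrite scaler_sumr.
under eq_bigr => i _ do
  rewrite scalerAr -gen_anticomm mulrDr !mulrA gen_sqr mulN1r.
rewrite big_split /= sum_gen_conj3 sumr_const card_ord -scaler_nat scalerN.
by rewrite -scaleNr -scalerDl scalerA; congr (_ *: _); ring.
Qed.

(** The terms T_A T_B e_A e_B and T_B T_A e_B e_A of T^2 cancel when e_A and e_B
    anticommute, that is, when A and B share 0 or 2 of their 3 indices.  The
    surviving terms have #|A :&: B| = 1 or 3, hence degree 4 or 0. *)
Lemma sqr_form3_eq0 C : #|C| != 0%N -> #|C| != 4%N -> (T * T) C = 0.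
Proof.
move=> C0 C4; apply/eqP; rewrite -[_ == 0](mulrn_eq0 _ 2) mulr2n; apply/eqP.
rewrite {2}cl_coefM (reindex_inj (@symdiff_inj _ C)) /= cl_coefM -big_split /=.
(* 2 (T^2)_C is the sum over A of the pair of terms (A, B) and (B, A), where
   B is the symmetric difference of A and C. *)
apply: big1 => A _; rewrite [symdiff (symdiff C A) C]symdiffC symdiffK.
rewrite [symdiff C A]symdiffC; set B := symdiff A C.
have [A3|/hT ->] := eqVneq #|A| 3%N; last by rewrite !(mulr0, mul0r) addr0.
have [B3|/hT ->] := eqVneq #|B| 3%N; last by rewrite !(mulr0, mul0r) addr0.
have AB : (#|C| + (#|A :&: B|).*2 = 6)%N.
  by have := card_symdiff A B; rewrite symdiffK A3 B3.
have even : odd #|A :&: B| = false by lia.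
have := cl_signC A B; rewrite A3 B3 even addbF => /addbP <-.
by rewrite signrN; ring.
Qed.

Lemma sqr_form3_0 : (T * T) finset.set0 = \sum_A T A ^+ 2.
Proof.
rewrite cl_coefM; apply: eq_bigr => A _; rewrite symdiffs0.
have [A3|/hT ->] := eqVneq #|A| 3%N; last by rewrite mulr0 expr0n.
by rewrite cl_signAA A3 mul1r expr2.
Qed.

Lemma sqr_form3D :
  T * T + \sum_i omega i * omega i = (- 2 * \sum_A T A ^+ 2) *: 1.
Proof.
have four0 : 4 != 0 :> R by rewrite pnatr_eq0.
apply: (scalerI four0); rewrite scalerDr.
have -> : 4 *: (\sum_i omega i * omega i) =
    (2 * (n%:R - 6) - n%:R) *: (T * T) + \sum_i e i * (T * T) * e i.
  have E i : 4 *: (omega i * omega i) =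
     e i * T * e i * T + T * (e i * T * e i) - T * T + e i * (T * T) * e i.
    have -> : 4 *: (omega i * omega i) = (- 2 *: omega i) * (- 2 *: omega i).
      by rewrite -scalerAl -scalerAr scalerA; congr (_ *: _); ring.
    rewrite -gen_anticomm mulrDl !mulrDr !mulrA.
    rewrite -[T * e i * e i]mulrA gen_sqr mulrN1 mulNr.
    by rewrite addrACA [X in _ + X]addrC -!addrA; congr (_ + _); exact: addrCA.
  rewrite scaler_sumr (eq_bigr _ (fun i _ => E i)) big_split /= sumrB big_split /=.
  rewrite -mulr_suml -mulr_sumr sum_gen_conj3 -scalerAl -scalerAr sumr_const.
  by rewrite card_ord -scaler_nat -scalerDl -scalerBl; congr (_ *: _ + _); ring.
rewrite -sqr_form3_0; have := sqr_form3_eq0; move: (T * T) => S S0.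
apply/ffunP=> C; rewrite 2!cl_coefD 4!cl_coefZ sum_gen_conj cl_coef1.
have [C0|C0] := eqVneq #|C| 0%N.
  by rewrite C0 (cards0_eq C0) eqxx mulr1 expr0 double0; ring.
rewrite -cards_eq0 (negPf C0) !mulr0.
have [C4|C4] := eqVneq #|C| 4%N; last by rewrite S0 //; ring.
by rewrite C4 -[(-1) ^+ 4]signr_odd expr0 (_ : 4.*2 = 8)%N //; ring.
Qed.

End Algebra.

Theorem theorem4p2 (R : realType) (n : nat) (T : exterior R n)
    (hT : is_form 3 T)
    (hpsi : exists psi : spinor R n,
      psi <> 0 /\
      forall a : Cl R n, g_star T a -> clifford_act a psi = 0) :
  T = 0.
Proof.
case: hpsi => psi [psi0 psiP].
(* The annihilator of psi, a left ideal of the Clifford algebra. *)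
pose ann (a : Cl R n) := spin_rep a *m psi = 0.
have annD a b : ann a -> ann b -> ann (a + b).
  by rewrite /ann spin_repD mulmxDl => -> ->; rewrite addr0.
have annM a b : ann b -> ann (a * b).
  by rewrite /ann spin_repM -mulmxA => ->; rewrite mulmx0.
have ann_sum (F : 'I_n -> Cl R n) : (forall i, ann (F i)) -> ann (\sum_i F i).
  move=> annF; apply: big_ind => //.
  by rewrite /ann -(scale0r (0 : Cl R n)) spin_repZ scale0r mul0mx.
have ann_omega i : ann (contract (delta_mx 0 i) T).
  by apply: psiP => S [_ sub]; apply: sub; exists (delta_mx 0 i).
have annZ k a : k != 0 -> ann (k *: a) -> ann a.
  rewrite /ann spin_repZ -scalemxAl => k0 /eqP.
  by rewrite scaler_eq0 fmorph_eq0 (negPf k0) => /eqP.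
have ann_T : ann T.
  apply: (@annZ 3); first by rewrite pnatr_eq0.
  by rewrite -(sum_gen_contract hT); apply: ann_sum => i; apply: annM.
have sum0 : \sum_A T A ^+ 2 = 0.
  have [//|c0] := eqVneq (\sum_A T A ^+ 2) 0; case: psi0.
  have : ann ((- 2 * \sum_A T A ^+ 2) *: 1).
    rewrite -(sqr_form3D hT); apply: annD; first exact: annM.
    by apply: ann_sum => i; apply: annM.
  move/annZ; rewrite mulf_neq0 ?oppr_eq0 ?pnatr_eq0 // => /(_ isT).
  by rewrite /ann spin_rep1 mul1mx.
apply/ffunP=> A; rewrite [RHS]ffunE; apply/eqP; rewrite -sqrf_eq0.
by apply/eqP/(psumr_eq0P _ sum0) => // B _; apply: sqr_ge0.
Qed.
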